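(* Let $m\ge 2$ be an integer and $e=3^h+1$, where $0\le h\le m-1$. Then the ternary cyclic code $\mathcal{C}_{(1,e)}$ has parameters $[3^m-1,\,3^m-1-2m,\,4]$ if and only if $m/\gcd(m,h)$ is odd, i.e., if and only if $x^e$ is planar over $\mathrm{GF}(3^m)$.
   Context: Let $q=3^m$, $n=q-1$, $\alpha$ a generator of $\mathrm{GF}(q)^*$, and $m_a(x)$ the minimal polynomial of $a\in\mathrm{GF}(q)$ over $\mathrm{GF}(3)$. $C_j$ denotes the $3$-cyclotomic coset modulo $n$ containing $j$, i.e. $\{j,3j,3^2j,\dots\}$ mod $n$. For $1<e<q-1$ with $e\notin C_1$, $\mathcal{C}_{(1,e)}$ is the cyclic code of length $n$ over $\mathrm{GF}(3)$ with generator polynomial $m_\alpha(x)m_{\alpha^e}(x)$. Here $\gcd(m,0)=m$. A function $f$ on $\mathrm{GF}(q)$ is planar if for every $a\in\mathrm{GF}(q)^*$ and $b\in\mathrm{GF}(q)$ the equation $f(x+a)-f(x)=b$ has at most one solution $x\in\mathrm{GF}(q)$. *)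

(* Defs.v *)
From HB Require Import structures.
From mathcomp Require Import all_boot all_order all_algebra.
From mathcomp Require Import vector falgebra fieldext finfield mxpoly.
Set Implicit Arguments. Unset Strict Implicit. Unset Printing Implicit Defensive.
Import GRing.Theory.
Local Open Scope ring_scope.

Definition hweight (n : nat) (c : 'rV['F_3]_n) : nat := #|[set i | c 0 i != 0]|.

(* A code C (set of words of length n over GF(3)) has parameters [n, k, d]:
   it has 3^k codewords (dimension k over GF(3), C being linear), and its
   minimum distance (= minimum nonzero weight for a linear code) is d. *)
Definition code_params (n : nat) (C : {set 'rV['F_3]_n}) (k d : nat) : Prop :=
  [/\ #|C| = (3 ^ k)%N,
      exists2 c, c \in C & c != 0 /\ hweight c = d
    & forall c, c \in C -> c != 0 -> (d <= hweight c)%N].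

Definition planar (K : finFieldType) (f : K -> K) : Prop :=
  forall a : K, a != 0 -> forall b : K, leq #|[set x : K | f (x + a) - f x == b]| 1.

Section CyclicCode.
Variables (F : finFieldType) (charF : 3%N \in [pchar F]).
Local Notation L := (pPrimeCharType charF).

Definition min_poly (a : L) : {poly L} := minPoly 1%VS a.

(* The cyclic code of length n over GF(3) with generator polynomial
   m_alpha(x) m_{alpha^e}(x): words (c_0,...,c_{n-1}) whose polynomial
   c_0 + c_1 x + ... + c_{n-1} x^{n-1} is a multiple of the generator. *)
Definition cyclic_code_1e (n : nat) (alpha : L) (e : nat) : {set 'rV['F_3]_n} :=
  [set c | (min_poly alpha * min_poly (alpha ^+ e)) %| map_poly (in_alg L) (rVpoly c)].
End CyclicCode.

(* Main.v *)
(** Put q = 3^h and e = q + 1. The map x |-> x^e is quadratic over GF(3), with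
    polar form B(x, y) = x^q y + x y^q and x^e = - B(x, x). The form B is
    anisotropic (B(x, y) = 0 only if x = 0 or y = 0) iff t^q = - t has no nonzero
    solution; this is planarity, since (x + a)^e - x^e = B(x, a) + a^e, and it
    holds iff m / gcd(m, h) is odd. A nonzero solution t gives the codeword of
    weight 3 supported at 1, t, 1 + t. If B is anisotropic, a relation of weight
    at most 3 forces some B(u, v) = 0 with u, v nonzero; a word of weight 4 comes
    from solving B(x + y, z) = - B(x, y) for z, which makes
    x^e + y^e + z^e = (x + y + z)^e; and x^e = y^e gives B(x + y, x - y) = 0, so
    x = y or x = - y, which forces alpha^e to have degree m. *)

Require Import Defs.
From HB Require Import structures.
From mathcomp Require Import all_boot all_order all_algebra.
From mathcomp Require Import vector falgebra fieldext finfield mxpoly.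
From mathcomp Require Import zify ring.
Import GRing.Theory.
Local Open Scope ring_scope.
Set Implicit Arguments. Unset Strict Implicit. Unset Printing Implicit Defensive.

(** * The quadratic form [x ^+ (q + 1)] and its polar form in characteristic 3 *)

Section Ternary.
Variables (K : fieldType) (charK : 3%N \in [pchar K]) (h : nat).
Implicit Types x y z t a b c : K.
Local Notation q := (3 ^ h)%N.

Let char3 : 3 = 0 :> K := pcharf0 charK.

(** [ring] works with integer coefficients; an explicit [z] absorbs the multiple of 3 by which the
    two sides differ. *)
Lemma modulo3 x y z : x = y + 3 * z -> x = y.
Proof. by rewrite char3 mul0r addr0. Qed.

Lemma oppr_neq_char3 x : x != 0 -> - x != x.
Proof.
apply: contraNneq => xN.
have: x + x = 0 by rewrite -{1}xN addNr.
move=> xx; apply/eqP; apply: (@etrans _ _ (- (x + x))); last by rewrite xx oppr0.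
by apply: (@modulo3 _ _ x); ring.
Qed.

Lemma expr3nD x y : (x + y) ^+ q = x ^+ q + y ^+ q.
Proof. by rewrite exprDn_pchar // (eq_pnat _ (pcharf_eq charK)) pnatX pnat_id. Qed.

Lemma expr3nN x : (- x) ^+ q = - x ^+ q.
Proof. by rewrite exprNn -signr_odd oddX orbT expr1 mulN1r. Qed.

Definition polar x y := x ^+ q * y + x * y ^+ q.
Definition no_antifixed := forall t, t ^+ q = - t -> t = 0.

Lemma polarC x y : polar x y = polar y x.
Proof. by rewrite /polar; ring. Qed.

Lemma polarDl x y z : polar (x + y) z = polar x z + polar y z.
Proof. by rewrite /polar expr3nD; ring. Qed.

Lemma polarNl x z : polar (- x) z = - polar x z.
Proof. by rewrite /polar expr3nN; ring. Qed.

Lemma polarDr x y z : polar z (x + y) = polar z x + polar z y.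
Proof. by rewrite ![polar z _]polarC polarDl. Qed.

Lemma polarNr x z : polar z (- x) = - polar z x.
Proof. by rewrite ![polar z _]polarC polarNl. Qed.

Definition polarE := (polarDl, polarDr, polarNl, polarNr).

Lemma expr_polarD x y :
  (x + y) ^+ (q + 1) = x ^+ (q + 1) + y ^+ (q + 1) + polar x y.
Proof. by rewrite !exprD !expr1 expr3nD /polar; ring. Qed.

Lemma exprN_even x : (- x) ^+ (q + 1) = x ^+ (q + 1).
Proof. by rewrite !exprD !expr1 expr3nN mulrNN. Qed.

Lemma expr_polar x : x ^+ (q + 1) = - polar x x.
Proof.
apply: (@modulo3 _ _ (x ^+ q * x)).
by rewrite /polar exprD expr1; ring.
Qed.

(** For nonzero [y], dividing [polar x y] by [y ^+ (q + 1)] leaves t^q + t with t = x / y. *)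
Lemma polar_eq0 x y : no_antifixed -> polar x y = 0 -> (x == 0) || (y == 0).
Proof.
move=> nz xy0; have [_|y0] := eqVneq y 0; rewrite ?orbT // orbF.
have: x / y = 0.
  apply: nz; rewrite expr_div_n.
  have yq0 : y ^+ q != 0 by rewrite expf_neq0.
  apply: (mulIf yq0); apply: (mulIf y0).
  rewrite mulfVK //; apply/eqP; rewrite -subr_eq0; apply/eqP.
  by rewrite -xy0 /polar; field.
by move=> /eqP; rewrite mulf_eq0 invr_eq0 (negPf y0) orbF.
Qed.

Lemma expr_inj_sign x y : no_antifixed ->
  x ^+ (q + 1) = y ^+ (q + 1) -> (x == y) || (x == - y).
Proof.
move=> nz; rewrite !expr_polar => /oppr_inj xy.
rewrite -(subr_eq0 x y) -addr_eq0; apply: polar_eq0 => //.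
by rewrite !polarE xy (polarC x y); ring.
Qed.

(** Opposite signs give x = y. Equal signs give x = - y, and since q + 1 is even the second relation
    becomes twice a nonzero power. *)
Lemma no_weight2 a b x y : a \in [:: 1; -1] -> b \in [:: 1; -1] ->
    x != 0 -> x != y ->
    a * x + b * y = 0 -> a * x ^+ (q + 1) + b * y ^+ (q + 1) = 0 -> False.
Proof.
move=> aP bP x0 xy e1 e2.
have nx: x ^+ (q + 1) != 0 by rewrite expf_neq0.
move: aP bP e1 e2; rewrite !inE => /orP[]/eqP-> /orP[]/eqP->;
  rewrite ?mul1r ?mulN1r -?opprD => e1 e2.
- move/eqP: e1; rewrite addr_eq0 => /eqP xE; move: nx e2.
  rewrite xE exprN_even => nx /eqP; rewrite addr_eq0 eq_sym => /eqP yN.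
  by case/eqP: (oppr_neq_char3 nx).
- by case/eqP: xy; apply/eqP; rewrite -subr_eq0 e1.
- by case/eqP: xy; apply/eqP; rewrite -subr_eq0 -oppr_eq0 opprB addrC e1.
- move/eqP: e1; rewrite oppr_eq0 addr_eq0 => /eqP xE; move: nx e2.
  rewrite xE exprN_even => nx /eqP; rewrite oppr_eq0 addr_eq0 eq_sym => /eqP yN.
  by case/eqP: (oppr_neq_char3 nx).
Qed.

Lemma no_weight3_pos b c x y z : no_antifixed ->
    b \in [:: 1; -1] -> c \in [:: 1; -1] ->
    x != 0 -> y != 0 -> z != 0 -> x != y -> x != z -> y != z ->
    x + b * y + c * z = 0 ->
    x ^+ (q + 1) + b * y ^+ (q + 1) + c * z ^+ (q + 1) = 0 -> False.
Proof.
move=> nz bP cP x0 y0 z0 xy xz yz.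
have npol u v : u != 0 -> v != 0 -> polar u v <> 0.
  by move=> u0 v0 /(polar_eq0 nz); rewrite (negPf u0) (negPf v0).
have sub0 u v : u != v -> u - v != 0 by rewrite subr_eq0.
move: bP cP; rewrite !inE => /orP[]/eqP-> /orP[]/eqP->;
  rewrite ?mul1r ?mulN1r => /eqP.
(* Here z = - (x + y), and modulo 3 the second relation reads [polar (x - y) (x - y) = 0]. *)
- rewrite addr_eq0 => /eqP/esym/(canRL (@opprK _)) zE; rewrite zE exprN_even expr_polarD.
  rewrite !expr_polar => e2; apply: (npol (x - y) (x - y)); rewrite ?sub0 //.
  rewrite -e2 !polarE (polarC y x).
  by apply: (@modulo3 _ _ (polar x x + polar y y - polar x y)); ring.
(* In this and the next two sign patterns one point is the sum of the other two, whose polar value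
   must then vanish. *)
- rewrite subr_eq0 => /eqP <-; rewrite expr_polarD => e2.
  by apply: (npol x y) => //; apply: oppr_inj; rewrite oppr0 -e2; ring.
- rewrite -addrA addrCA addrC subr_eq0 => /eqP yE; rewrite -yE expr_polarD => e2.
  by apply: (npol x z) => //; apply: oppr_inj; rewrite oppr0 -e2; ring.
- rewrite -addrA -opprD subr_eq0 => /eqP xE; rewrite xE expr_polarD => e2.
  by apply: (npol y z) => //; rewrite -e2; ring.
Qed.

(** Multiplying both relations by [a], where a^2 = 1, makes the leading coefficient 1. *)
Lemma no_weight3 a b c x y z : no_antifixed ->
    a \in [:: 1; -1] -> b \in [:: 1; -1] -> c \in [:: 1; -1] ->
    x != 0 -> y != 0 -> z != 0 -> x != y -> x != z -> y != z ->
    a * x + b * y + c * z = 0 ->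
    a * x ^+ (q + 1) + b * y ^+ (q + 1) + c * z ^+ (q + 1) = 0 -> False.
Proof.
move=> nz aP bP cP x0 y0 z0 xy xz yz e1 e2.
have sgnM u v : u \in [:: 1; -1] -> v \in [:: 1; -1] -> u * v \in [:: 1 : K; -1].
  by rewrite !inE => /orP[]/eqP-> /orP[]/eqP->;
    rewrite ?mul1r ?mulN1r ?opprK eqxx ?orbT.
have aa : a * a = 1.
  by move: aP; rewrite !inE => /orP[]/eqP->; rewrite ?mulrNN mul1r.
apply: (@no_weight3_pos (a * b) (a * c) x y z) => //; try exact: sgnM.
  by rewrite -[x]mul1r -aa -!mulrA -!mulrDr e1 mulr0.
by rewrite -[X in X + _ + _]mul1r -aa -!mulrA -!mulrDr e2 mulr0.
Qed.
End Ternary.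

(** * Finite fields: the parity criterion, planarity, and solving for a fourth point *)

Section FiniteTernary.
Variables (K : finFieldType) (charK : 3%N \in [pchar K]) (h m : nat).
Local Notation q := (3 ^ h)%N.

Lemma antifixed_iter (d j : nat) (t : K) :
  t ^+ (3 ^ d) = - t -> t ^+ (3 ^ (d * j)) = (-1) ^+ j * t.
Proof.
move=> tN; elim: j => [|j IH]; first by rewrite muln0 !expr1 mul1r.
rewrite mulnS addnC expnD exprM IH exprMn tN -exprM mulnC exprM.
by rewrite expr3nN // expr1n exprSr !mulrN mulr1 mulNr.
Qed.

(** Let k = m / gcd(m, h). Raising [t] k times to the power q gives (-1)^k t = - t; but hk is a
    multiple of m, so the result is also t. *)
Lemma odd_no_antifixed : (0 < m)%N -> #|K| = (3 ^ m)%N ->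
  odd (m %/ gcdn m h) -> no_antifixed K h.
Proof.
move=> m0 cardK odd_k t /(antifixed_iter (m %/ gcdn m h)).
rewrite -signr_odd odd_k expr1 mulN1r.
rewrite -{1}(divnK (dvdn_gcdr m h)) -mulnA (mulnC (gcdn m h)) divnK ?dvdn_gcdl //.
rewrite mulnC expnM -cardK => tt; apply/eqP; apply/negPn/negP => t0.
case/eqP: (oppr_neq_char3 charK t0); rewrite -tt.
by elim: (h %/ _)%N => [|j IH]; rewrite ?expr1 // expnSr exprM IH expf_card.
Qed.

Lemma prim_root_half (n : nat) (a : K) : (0 < n)%N ->
  (n.*2).-primitive_root a -> a ^+ n = -1.
Proof.
move=> n0 prim_a; have: (a ^+ n) ^+ 2 == 1.
  by rewrite -exprM muln2 prim_expr_order.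
rewrite sqrf_eq1 => /orP[|/eqP//]; rewrite -(prim_order_dvd prim_a) => /dvdn_leq.
by rewrite -addnn => /(_ n0); lia.
Qed.

(** By contraposition: if k = m / d is even, a suitable power of the generator satisfies t^(3^d) = -
    t, and h / d being odd turns this into t^q = - t. *)
Lemma no_antifixed_odd (a : K) : (0 < m)%N ->
  (3 ^ m - 1)%N.-primitive_root a -> no_antifixed K h -> odd (m %/ gcdn m h).
Proof.
move=> m0 prim_a nz; apply/negPn/negP => even_k.
set d := gcdn m h in even_k; set k := (m %/ d)%N in even_k.
have d0 : (0 < d)%N by rewrite gcdn_gt0 m0.
have mE : m = (d * k)%N by rewrite mulnC divnK ?dvdn_gcdl.
have hE : h = (d * (h %/ d))%N by rewrite mulnC divnK ?dvdn_gcdr.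
have k0 : (0 < k)%N by move: m0; rewrite mE muln_gt0 => /andP[].
have odd_j : odd (h %/ d).
  (* Were m / d and h / d both even, 2d would divide their gcd d. *)
  apply/negPn/negP => even_j.
  have: (d * 2 %| d)%N.
    by rewrite {2}/d dvdn_gcd {1}mE {1}hE !dvdn_pmul2l // !dvdn2 even_k even_j.
  by move/dvdn_leq => /(_ d0); lia.
have odd_D : odd (3 ^ d) by rewrite oddX orbT.
have D_gt1 : (1 < 3 ^ d)%N by rewrite -{1}(expn0 3) ltn_exp2l.
(* As k is even, 3^m - 1 = u (3^d - 1)(3^d + 1) for some u, and 3^d + 1 is even. This choice of s
   makes a^(s (3^d - 1)) the half-order power of [a], which is -1. *)
have [s sE] : exists s, (3 ^ m - 1 = (s * (3 ^ d - 1)).*2)%N.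
  have: (((3 ^ d) ^ 2).-1 %| (((3 ^ d) ^ 2) ^ k./2).-1)%N by exact: dvdn_pred_predX.
  have -> : (((3 ^ d) ^ 2) ^ k./2 = 3 ^ m)%N.
    by rewrite -!expnM mul2n (even_halfK even_k) -mE.
  move=> /dvdnP[u uE].
  exists (u * (3 ^ d).+1./2)%N; rewrite subn1 uE.
  have D2 : ((3 ^ d).+1./2).*2 = (3 ^ d).+1 by rewrite even_halfK //= odd_D.
  by move: ((3 ^ d).+1./2) D2 D_gt1 => v; move: (3 ^ d)%N => D; nia.
have sD0 : (0 < s * (3 ^ d - 1))%N.
  rewrite lt0n; apply/eqP => sD0; move: (prim_order_gt0 prim_a).
  by rewrite sE sD0.
have tN : (a ^+ s) ^+ (3 ^ d) = - a ^+ s.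
  rewrite -[X in _ ^+ X](subnK (ltnW D_gt1)) exprD expr1 -exprM.
  by rewrite prim_root_half -?sE // mulN1r.
have: a ^+ s = 0.
  apply: nz; rewrite {1}hE (antifixed_iter (h %/ d)%N tN).
  by rewrite -signr_odd odd_j expr1 mulN1r.
move/eqP; rewrite expf_eq0 => /andP[_ /eqP a0]; move: (prim_expr_order prim_a).
by move/eqP; rewrite a0 expr0n -(prednK (prim_order_gt0 prim_a)) eq_sym oner_eq0.
Qed.

Lemma planar_no_antifixed :
  planar (fun x : K => x ^+ (q + 1)) <-> no_antifixed K h.
Proof.
have dE (x a : K) : (x + a) ^+ (q + 1) - x ^+ (q + 1) = a ^+ (q + 1) + polar h x a.
  by rewrite expr_polarD //; ring.
split=> [pl t tN | nz a a0 b].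
  (* With a = b = 1, both 0 and [t] solve the difference equation. *)
  have /card_le1_eqP := pl 1 (oner_neq0 _) 1; apply; rewrite inE dE expr1n.
    by rewrite /polar expr1n mulr1 expr0n expn_eq0 /= mulr1 !addr0.
  by rewrite /polar tN expr1n !mulr1 addNr addr0.
apply/card_le1_eqP => x y; rewrite !inE !dE => /eqP xb /eqP yb.
apply/eqP; rewrite -subr_eq0.
suff: polar h (y - x) a = 0 by move/(polar_eq0 nz); rewrite (negPf a0) orbF.
by rewrite polarDl // polarNl //; move: xb; rewrite -yb => /addrI ->; rewrite subrr.
Qed.

(** The power identity amounts to [polar h (x + y) z = - polar h x y]. Anisotropy makes the additive
    map [polar h (x + y)] injective, hence bijective on a finite field. *)
Lemma weight4_solution (x y : K) : no_antifixed K h ->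
    x != 0 -> y != 0 -> x != y -> x != - y ->
  exists z, [/\ z != 0, (x + y + z) \notin [:: 0; x; y; z]
    & (x + y + z) ^+ (q + 1) = x ^+ (q + 1) + y ^+ (q + 1) + z ^+ (q + 1)].
Proof.
move=> nz x0 y0 xy xNy.
have npol (u v : K) : u != 0 -> v != 0 -> polar h u v <> 0.
  by move=> u0 v0 /(polar_eq0 nz); rewrite (negPf u0) (negPf v0).
have s0 : x + y != 0 by rewrite addr_eq0.
have polar_inj : injective (polar h (x + y)).
  move=> u v uv; apply/eqP; rewrite -subr_eq0; apply/negPn/negP => uv0.
  by apply: (npol _ _ s0 uv0); rewrite polarDr // polarNr // uv subrr.
pose z := invF polar_inj (- polar h x y).
have zE : polar h (x + y) z = - polar h x y by rewrite f_invF.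
have z_ne u : polar h (x + y) u != - polar h x y -> z != u.
  by apply: contraNneq => <-; rewrite zE.
have ne0 (u v : K) : u != 0 -> v != 0 -> polar h u v != 0 by move=> u0 v0; apply/eqP/npol.
exists z; split; last 1 first.
- by rewrite !expr_polarD // zE addrAC addrK.
- apply: z_ne; rewrite /polar expr0n expn_eq0 /= !mulr0 addr0 eq_sym oppr_eq0.
  exact: ne0.
(* The first three conditions exclude z = - (x + y), - y, - x; there the polar equation would force
   [polar] to vanish at the pairs (x - y, x - y), (y, y), (x, x). The last is x + y != 0. *)
rewrite !inE !negb_or; apply/and4P; split.
- rewrite addrC addr_eq0; apply: z_ne; rewrite polarNr // eqr_opp -subr_eq0.
  rewrite (_ : _ - _ = polar h (x - y) (x - y)); first by rewrite ne0 // subr_eq0.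
  rewrite !polarE // (polarC h y x); apply: (@modulo3 _ charK _ _ (polar h x y)); ring.
- rewrite -addrA addrC -subr_eq0 addrK addrC addr_eq0; apply: z_ne.
  rewrite polarNr // eqr_opp polarDl // -subr_eq0 addrC addKr; exact: ne0.
- rewrite addrAC -subr_eq0 addrK addrC addr_eq0; apply: z_ne.
  rewrite polarNr // eqr_opp polarDl // (polarC h y x) -subr_eq0 addrK; exact: ne0.
- by rewrite -subr_eq0 addrK.
Qed.
End FiniteTernary.

(** * Minimal polynomials, membership by evaluation, and Hamming weight *)

Section CodeWords.
Variables (F : finFieldType) (charF : 3%N \in [pchar F]).
Local Notation L := (pPrimeCharType charF).
Implicit Types (a x : L) (p : {poly 'F_3}).

Lemma min_poly_dvdE a p :
  (min_poly a %| map_poly (in_alg L) p) = root (map_poly (in_alg L) p) a.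
Proof.
apply/idP/idP => [min_dvd|].
  rewrite root_factor_theorem (dvdp_trans _ min_dvd) //.
  by rewrite -root_factor_theorem root_minPoly.
by apply: minPoly_dvdp; apply/polyOver1P; exists p.
Qed.

(** Both polynomials come from GF(3), so their gcd does too; by irreducibility it is 1 or
    [min_poly a] up to a unit, and the latter would make [a] a root of [min_poly x]. *)
Lemma coprime_min_poly a x : ~~ root (min_poly x) a ->
  coprimep (min_poly a) (min_poly x).
Proof.
have /polyOver1P[p pE] := minPolyOver 1 a; have /polyOver1P[r rE] := minPolyOver 1 x.
move=> not_root; rewrite /coprimep /min_poly pE rE -gcdp_map.
have: (map_poly (in_alg L) (gcdp p r) %= min_poly a) ||
    (map_poly (in_alg L) (gcdp p r) %= 1).
  apply: minPoly_irr; first by apply/polyOver1P; exists (gcdp p r).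
  by rewrite pE dvdp_map dvdp_gcdl.
case/orP => [gcd_a | /eqp_size->]; last by rewrite size_poly1.
case/negP: not_root; rewrite root_factor_theorem /min_poly rE.
apply: dvdp_trans (_ : map_poly (in_alg L) (gcdp p r) %| _).
  by rewrite (eqp_dvdr _ gcd_a) -root_factor_theorem root_minPoly.
by rewrite dvdp_map dvdp_gcdr.
Qed.

Definition eval n (c : 'rV['F_3]_n) x : L := (map_poly (in_alg L) (rVpoly c)).[x].

Lemma mem_cyclic_code n a e (c : 'rV['F_3]_n) :
    coprimep (min_poly a) (min_poly (a ^+ e)) ->
  (c \in cyclic_code_1e n a e) = (eval c a == 0) && (eval c (a ^+ e) == 0).
Proof. by move=> co; rewrite inE Gauss_dvdp // !min_poly_dvdE. Qed.

Lemma evalD n (c d : 'rV['F_3]_n) x : eval (c + d) x = eval c x + eval d x.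
Proof. by rewrite /eval raddfD rmorphD hornerD. Qed.

Lemma evalN n (c : 'rV['F_3]_n) x : eval (- c) x = - eval c x.
Proof. by rewrite /eval raddfN rmorphN hornerN. Qed.

Lemma eval_delta n (i : 'I_n) x : eval (delta_mx 0 i) x = x ^+ i.
Proof. by rewrite /eval rVpoly_delta map_polyXn hornerXn. Qed.

(** Summing over an explicit list of nonzero positions allows case analysis on words of small
    weight. *)
Lemma eval_support n (c : 'rV['F_3]_n) x :
  eval c x = \sum_(i <- enum [set i | c 0 i != 0]) (c 0 i)%:A * x ^+ i.
Proof.
rewrite /eval (horner_coef_wide (n := n)); last first.
  by rewrite (leq_trans (size_poly _ _)) // size_poly.
rewrite big_enum /= [RHS]big_mkcond /=; apply: eq_bigr => i _.
by rewrite coef_map coef_rVpoly_ord inE; case: eqP => //= ->; rewrite scale0r mul0r.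
Qed.

Lemma hweightD n (c d : 'rV['F_3]_n) : (hweight (c + d) <= hweight c + hweight d)%N.
Proof.
rewrite /hweight (leq_trans _ (leq_card_setU _ _)) // subset_leq_card //.
apply/subsetP => i; rewrite !inE mxE -negb_and; apply: contra => /andP[/eqP-> /eqP->].
by rewrite addr0.
Qed.

Lemma hweightN n (c : 'rV['F_3]_n) : hweight (- c) = hweight c.
Proof. by congr #|pred_of_set _|; apply/setP => i; rewrite !inE mxE oppr_eq0. Qed.

Lemma hweight_delta n (i : 'I_n) : hweight (delta_mx 0 i : 'rV['F_3]_n) = 1%N.
Proof.
rewrite /hweight (_ : [set _ | _] = [set i]) ?cards1 //.
by apply/setP => j; rewrite !inE mxE eqxx /=; case: (j == i).
Qed.

Lemma F3_sign (u : 'F_3) : u != 0 -> u%:A \in [:: 1; -1 : L].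
Proof.
move=> u0; have [-> | ->] : u = 1 \/ u = -1.
- by case: u u0 => [[|[|[|i]]] // Hi] _; [left | right]; apply: val_inj.
- by rewrite scale1r inE eqxx.
by rewrite scaleN1r !inE eqxx orbT.
Qed.

(** * Dimension and minimum distance for a primitive [alpha] *)

Variables (m : nat) (alpha : L).
Hypotheses (m_ge2 : (2 <= m)%N) (cardF : #|F| = (3 ^ m)%N).
Hypothesis prim_alpha : (3 ^ m - 1)%N.-primitive_root alpha.

Lemma exp3_gt8 : (8 < 3 ^ m)%N.
Proof. by rewrite (@leq_trans (3 ^ 2)) // leq_exp2l. Qed.

(** Turns a nonzero field element into a coordinate of the code. *)
Lemma logP x : x != 0 -> {i : 'I_(3 ^ m - 1) | x = alpha ^+ i}.
Proof.
move=> x0; apply: (prim_rootP prim_alpha); apply: (mulfI x0); rewrite mulr1 -exprS.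
have -> : (3 ^ m - 1).+1 = #|F| by rewrite cardF; have := exp3_gt8; lia.
exact: (@expf_card F).
Qed.

Lemma alpha_neq0 i : alpha ^+ i != 0.
Proof.
rewrite expf_eq0 negb_and orbC; apply/orP; left; apply/eqP => a0.
have /eqP := prim_expr_order prim_alpha; rewrite a0 expr0n.
by rewrite -(prednK (prim_order_gt0 prim_alpha)) /= eq_sym oner_eq0.
Qed.

Lemma alpha_inj (i j : 'I_(3 ^ m - 1)) : i != j -> alpha ^+ i != alpha ^+ j.
Proof. by rewrite (eq_prim_root_expr prim_alpha) !modn_small. Qed.

(** Let n = 3^m - 1. Since n and 3^h + 1 are even, [alpha ^+ (3 ^ h + 1)] is a root of X^(n/2) - 1,
    whereas [alpha], of order n, is not. *)
Lemma coprime_code_factors h :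
  coprimep (min_poly alpha) (min_poly (alpha ^+ (3 ^ h + 1))).
Proof.
apply: coprime_min_poly; apply/negP => root_alpha.
pose r : {poly 'F_3} := 'X^((3 ^ m - 1)./2) - 1.
have rE : map_poly (in_alg L) r = 'X^((3 ^ m - 1)./2) - 1.
  by rewrite rmorphB /= map_polyXn rmorph1.
have even_n : ~~ odd (3 ^ m - 1).
  by rewrite oddB ?expn_gt0 // oddX orbT.
have even_e : ~~ odd (3 ^ h + 1) by rewrite oddD oddX orbT.
have: root (map_poly (in_alg L) r) alpha.
  have dvd_r : min_poly (alpha ^+ (3 ^ h + 1)) %| map_poly (in_alg L) r.
    rewrite min_poly_dvdE rE /root !hornerE subr_eq0 -exprM.
    rewrite -(prim_order_dvd prim_alpha); apply/dvdnP; exists (3 ^ h + 1)./2.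
    by rewrite -[in RHS](even_halfK even_n) -doubleMr doubleMl even_halfK.
  by rewrite root_factor_theorem (dvdp_trans _ dvd_r) // -root_factor_theorem.
rewrite rE /root !hornerE subr_eq0 -(prim_order_dvd prim_alpha) => /dvdn_leq.
by have := exp3_gt8; lia.
Qed.

(** The degree of x is at most the dimension m of the field, and it is itself a positive d with
    x^(3^d) = x. *)
Lemma size_min_poly x :
  (forall d, (0 < d)%N -> x ^+ (3 ^ d) = x -> (m <= d)%N) ->
  size (min_poly x) = m.+1.
Proof.
move=> deg_ge; rewrite size_minPoly adjoin_degreeE dimv1 divn1; congr _.+1.
apply/eqP; rewrite eqn_leq; apply/andP; split.
  have <- : \dim {:L} = m.
    by rewrite pprimeChar_dimf -[#|_|]/#|F| cardF pfactorK.
  exact: dimvS (subvf _).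
apply: deg_ge; first exact: adim_gt0.
have := memv_adjoin 1 x; rewrite Fermat's_little_theorem card_Fp // => /eqP.
exact.
Qed.

Lemma size_min_poly_alpha : size (min_poly alpha) = m.+1.
Proof.
apply: size_min_poly => d d0 /eqP; rewrite -{2}(expr1 alpha).
rewrite (eq_prim_root_expr prim_alpha) eqn_mod_dvd ?expn_gt0 // => /dvdn_leq.
have lt3d : (1 < 3 ^ d)%N by rewrite -{1}(expn0 3) ltn_exp2l.
rewrite subn_gt0 => /(_ lt3d) le3.
by rewrite -(@leq_exp2l 3) //; move: le3 exp3_gt8; lia.
Qed.

Lemma size_min_poly_expr h : no_antifixed L h ->
  size (min_poly (alpha ^+ (3 ^ h + 1))) = m.+1.
Proof.
move=> nz; apply: size_min_poly => d d0; rewrite exprAC => /(expr_inj_sign charF nz) aP.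
(* Squaring removes the sign in alpha^(3^d) = ± alpha. Then 3^m - 1 divides 2 (3^d - 1), so 3^m <
   3^(d+1). *)
have: alpha ^+ (2 * 3 ^ d) == alpha ^+ 2.
  rewrite mulnC exprM.
  by case/orP: aP => /eqP->; rewrite ?sqrrN.
have lt3d : (1 < 3 ^ d)%N by rewrite -{1}(expn0 3) ltn_exp2l.
rewrite (eq_prim_root_expr prim_alpha) eqn_mod_dvd; last by lia.
move=> /dvdn_leq le3.
have : (3 ^ m - 1 <= 2 * 3 ^ d - 2)%N by apply: le3; lia.
move=> le3'; rewrite -ltnS -(@ltn_exp2l 3) // expnS.
by move: le3' exp3_gt8; lia.
Qed.

(** Multiplication by the generator, of degree 2m, is a bijection from words of length n - 2m onto
    the code. *)
Lemma card_cyclic_code h : no_antifixed L h ->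
  #|cyclic_code_1e (3 ^ m - 1) alpha (3 ^ h + 1)| = (3 ^ (3 ^ m - 1 - 2 * m))%N.
Proof.
move=> nz; have /polyOver1P[g gE] :
    min_poly alpha * min_poly (alpha ^+ (3 ^ h + 1)) \is a polyOver 1%VS.
  by rewrite rpredM // minPolyOver.
have size_g : size g = (2 * m).+1.
  rewrite -(size_map_poly (in_alg L)) -gE size_proper_mul.
    by rewrite size_min_poly_alpha size_min_poly_expr //; lia.
  rewrite mulf_neq0 // lead_coef_eq0 -size_poly_gt0.
    by rewrite size_min_poly_alpha.
  by rewrite size_min_poly_expr.
have g0 : g != 0 by rewrite -size_poly_gt0 size_g.
have le_n : (2 * m <= 3 ^ m - 1)%N.
  by rewrite leq_subRL ?expn_gt0 //; elim: (m) => // k; rewrite expnS; lia.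
pose enc (u : 'rV['F_3]_(3 ^ m - 1 - 2 * m)) : 'rV['F_3]_(3 ^ m - 1) :=
  poly_rV (g * rVpoly u).
have encK u : rVpoly (enc u) = g * rVpoly u.
  rewrite poly_rV_K // (leq_trans (size_polyMleq _ _)) // size_g addSn /=.
  by rewrite -leq_subRL // size_poly.
have enc_inj : injective enc.
  move=> u v /(congr1 rVpoly); rewrite !encK => /(mulfI g0).
  exact: (can_inj rVpolyK).
rewrite (_ : cyclic_code_1e _ _ _ = [set enc u | u in setT]).
  by rewrite card_imset // cardsT card_mx card_Fp // mul1n.
apply/setP => c; rewrite inE gE dvdp_map; apply/idP/imsetP => [|[u _ ->]]; last first.
  by rewrite encK dvdp_mulr.
case/dvdpP => r cE; exists (poly_rV r) => //.
apply: (can_inj rVpolyK); rewrite encK mulrC poly_rV_K //.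
have [-> | r0] := eqVneq r 0; first by rewrite size_poly0.
have: (size (r * g)%R <= 3 ^ m - 1)%N by rewrite -cE size_poly.
by rewrite size_mul // size_g addnS /= addnC -leq_subRL.
Qed.

Lemma hweight_ge4 h c : no_antifixed L h ->
    c \in cyclic_code_1e (3 ^ m - 1) alpha (3 ^ h + 1) -> c != 0 ->
  (4 <= hweight c)%N.
Proof.
move=> nz; rewrite mem_cyclic_code ?coprime_code_factors // !eval_support.
move=> /andP[/eqP e1 /eqP e2] c0; rewrite ltnNge; apply/negP.
move: e1 e2; rewrite /hweight cardE.
have: {subset enum [set i | c 0 i != 0] <= [pred i | c 0 i != 0]}.
  by move=> i; rewrite mem_enum inE.
have := enum_uniq [set i | c 0 i != 0].
(* Supports of size 0 to 3. Exchanging exponents in the second check turns it into a relation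
   between the powers of the points alpha^i. *)
case enumE: (enum _) => [|i [|j [|k [|//]]]] //= Us Ss; rewrite ?big_cons ?big_nil.
- case/eqP: c0; apply/rowP => i; rewrite mxE; apply/eqP/negPn/negP => ci.
  by have := mem_enum [set i | c 0 i != 0] i; rewrite enumE !inE ci.
- have ci : c 0 i != 0 by apply: (Ss i); rewrite inE.
  rewrite addr0 => /eqP; rewrite mulf_eq0 (negPf (alpha_neq0 _)) orbF.
  by case/F3_sign: ci; rewrite !inE => /orP[]/eqP->; rewrite ?oppr_eq0 oner_eq0.
- rewrite !addr0 => e1 e2 _; move: Us; rewrite inE andbT => ij.
  apply: (@no_weight2 L charF h (c 0 i)%:A (c 0 j)%:A (alpha ^+ i) (alpha ^+ j)).
  + by apply/F3_sign/(Ss i); rewrite inE eqxx.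
  + by apply/F3_sign/(Ss j); rewrite !inE eqxx orbT.
  + exact: alpha_neq0.
  + exact: alpha_inj.
  + exact: e1.
  + by move: e2; rewrite ![(_ ^+ (3 ^ h + 1)) ^+ _]exprAC.
rewrite !addr0 !addrA => e1 e2 _.
move: Us; rewrite !inE negb_or andbT => /andP[/andP[ij ik] jk].
apply: (@no_weight3 L charF h (c 0 i)%:A (c 0 j)%:A (c 0 k)%:A
  (alpha ^+ i) (alpha ^+ j) (alpha ^+ k) nz); try exact: alpha_neq0; try exact: alpha_inj.
+ by apply/F3_sign/(Ss i); rewrite !inE eqxx.
+ by apply/F3_sign/(Ss j); rewrite !inE eqxx orbT.
+ by apply/F3_sign/(Ss k); rewrite !inE eqxx !orbT.
+ exact: e1.
by move: e2; rewrite ![(_ ^+ (3 ^ h + 1)) ^+ _]exprAC.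
Qed.

Lemma delta_sub_neq0 n (c : 'rV['F_3]_n) i : c 0 i = 0 -> c - delta_mx 0 i != 0.
Proof.
move=> ci; apply/eqP => /rowP/(_ i)/eqP.
by rewrite !mxE ci !eqxx sub0r oppr_eq0 oner_eq0.
Qed.

Lemma delta_mx_eq0 n (i j : 'I_n) : i != j -> (delta_mx 0 i : 'rV['F_3]_n) 0 j = 0.
Proof. by move=> ij; rewrite mxE eqxx eq_sym (negPf ij). Qed.

Lemma weight4_codeword h : no_antifixed L h ->
  exists2 c, c \in cyclic_code_1e (3 ^ m - 1) alpha (3 ^ h + 1)
    & c != 0 /\ hweight c = 4%N.
Proof.
move=> nz.
have prim_neq k : (0 < k <= 2)%N -> alpha ^+ k != 1.
  move=> k12; rewrite -(prim_order_dvd prim_alpha); apply/negP => /dvdn_leq.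
  by move: exp3_gt8; lia.
have a1 : 1 != alpha by rewrite eq_sym -(expr1 alpha) prim_neq.
have aN1 : 1 != - alpha.
  apply/eqP => a1N; have := prim_neq 2%N isT.
  by rewrite -sqrrN -a1N expr1n eqxx.
have a0 : alpha != 0 by have := alpha_neq0 1; rewrite expr1.
(* The pair 1, [alpha] is admissible because the order of [alpha] exceeds 2. *)
have [z [z0]] := @weight4_solution L charF h 1 alpha nz (oner_neq0 _) a0 a1 aN1.
rewrite !inE !negb_or => /and4P[w0 w1 w2 w3] wE.
have [i iE] := logP (oner_neq0 _); have [j jE] := logP a0.
have [k kE] := logP z0; have [l lE] := logP w0.
pose c : 'rV['F_3]_(3 ^ m - 1) :=
  delta_mx 0 i + delta_mx 0 j + delta_mx 0 k - delta_mx 0 l.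
have neq_l (u : 'I_(3 ^ m - 1)) : 1 + alpha + z != alpha ^+ u -> u != l.
  by apply: contraNneq => ->; rewrite lE.
have c0 : c != 0.
  apply: delta_sub_neq0; rewrite mxE [X in X + _]mxE.
  by rewrite !delta_mx_eq0 ?addr0 // neq_l // -?iE -?jE -?kE.
have cC : c \in cyclic_code_1e (3 ^ m - 1) alpha (3 ^ h + 1).
  rewrite mem_cyclic_code ?coprime_code_factors // !(evalD, evalN, eval_delta).
  rewrite ![(_ ^+ (3 ^ h + 1)) ^+ _]exprAC -iE -jE -kE -lE -wE subrr.
  by rewrite subrr eqxx.
(* Four unit vectors bound the weight by 4 from above; the minimum distance bounds it from below, as
   [c] is nonzero at position [l]. *)
exists c => //; split=> //; apply/eqP; rewrite eqn_leq (hweight_ge4 nz) // andbT.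
apply: leq_trans (hweightD _ _) _; rewrite hweightN hweight_delta addn1 ltnS.
apply: leq_trans (hweightD _ _) _; rewrite hweight_delta addn1 ltnS.
by apply: leq_trans (hweightD _ _) _; rewrite !hweight_delta.
Qed.

(** A nonzero [t] with t^q = - t has [polar h 1 t = 0], so (1 + t)^e = 1 + t^e, a nonzero codeword
    of weight at most 3. *)
Lemma min_weight4_no_antifixed h :
    (forall c, c \in cyclic_code_1e (3 ^ m - 1) alpha (3 ^ h + 1) -> c != 0 ->
       (4 <= hweight c)%N) ->
  no_antifixed L h.
Proof.
move=> dist t tN; apply/eqP/negPn/negP => t0.
(* The value t = -1 is excluded since (-1)^q = -1, as q is odd. *)
have s0 : 1 + t != 0.
  rewrite addr_eq0 eq_sym; apply/eqP => tE; move: tN.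
  rewrite -[t]opprK tE expr3nN // expr1n opprK => /eqP.
  by apply/negP/(@oppr_neq_char3 L charF); exact: oner_neq0.
have [i iE] := logP (oner_neq0 _); have [j jE] := logP t0; have [k kE] := logP s0.
pose c : 'rV['F_3]_(3 ^ m - 1) := delta_mx 0 i + delta_mx 0 j - delta_mx 0 k.
have neq_k (u : 'I_(3 ^ m - 1)) : 1 + t != alpha ^+ u -> u != k.
  by apply: contraNneq => ->; rewrite kE.
have c0 : c != 0.
  apply: delta_sub_neq0; rewrite mxE !delta_mx_eq0 ?addr0 // neq_k // -?iE -?jE.
    by rewrite -subr_eq0 addrK oner_neq0.
  by rewrite -subr_eq0 addrC addKr.
have cC : c \in cyclic_code_1e (3 ^ m - 1) alpha (3 ^ h + 1).
  rewrite mem_cyclic_code ?coprime_code_factors // !(evalD, evalN, eval_delta).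
  rewrite ![(_ ^+ (3 ^ h + 1)) ^+ _]exprAC -iE -jE -kE subrr eqxx /=.
  by rewrite expr_polarD // /polar tN !expr1n !mul1r subrr addr0 subrr.
have := dist c cC c0; apply/negP; rewrite -ltnNge ltnS.
apply: leq_trans (hweightD _ _) _; rewrite hweightN hweight_delta addn1 ltnS.
by apply: leq_trans (hweightD _ _) _; rewrite !hweight_delta.
Qed.
End CodeWords.

Theorem theorem4 (m h : nat) (F : finFieldType) (charF : 3%N \in [pchar F])
    (alpha : pPrimeCharType charF) :
  (2 <= m)%N -> (h <= m - 1)%N -> #|F| = (3 ^ m)%N ->
  (3 ^ m - 1)%N.-primitive_root alpha ->
  (code_params (cyclic_code_1e (3 ^ m - 1) alpha (3 ^ h + 1))
               (3 ^ m - 1 - 2 * m) 4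
     <-> odd (m %/ gcdn m h))
  /\ (odd (m %/ gcdn m h) <-> planar (fun x : F => x ^+ (3 ^ h + 1))).
Proof.
move=> m_ge2 _ cardF prim_alpha.
have m_gt0 : (0 < m)%N by exact: ltnW.
(* Both equivalences pass through [no_antifixed]. *)
have oddP : odd (m %/ gcdn m h) <-> no_antifixed F h.
  by split; [exact: odd_no_antifixed | exact: (no_antifixed_odd charF m_gt0 prim_alpha)].
split; last by rewrite planar_no_antifixed.
rewrite oddP; split=> [[_ _] | nz]; first exact: min_weight4_no_antifixed.
split; first exact: card_cyclic_code.
  exact: weight4_codeword.
by move=> c; exact: hweight_ge4.
Qed.
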